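(* For every integer $n\ge 2$, the group $BS(1,n)=\langle a,t\mid tat^{-1}=a^n\rangle$ is $\mathcal H$-inaccessible; that is, the poset $\mathcal H(BS(1,n))$ does not contain a largest element.
   Context: For a group $G$ and a (possibly infinite) generating set $S$, let $\Gamma(G,S)$ be the Cayley graph and $\|\cdot\|_S$ the word norm. For generating sets $S,T$ of $G$ write $T\preceq S$ if $\sup_{g\in S}\|g\|_T<\infty$. This is a preorder; put $S\sim T$ if $S\preceq T$ and $T\preceq S$, let $[S]$ be the equivalence class of $S$, and order the classes by $[S]\preccurlyeq[T]$ if and only if $S\preceq T$ (i.e. $\sup_{g\in T}\|g\|_S<\infty$). The poset of hyperbolic structures on $G$ is $\mathcal H(G)=\{[S]\mid G=\langle S\rangle,\ \Gamma(G,S)\text{ is (Gromov) hyperbolic}\}$ with the partial order $\preccurlyeq$. A group $G$ is $\mathcal H$-accessible if $\mathcal H(G)$ contains a largest element (an element $\succcurlyeq$ every element), and $\mathcal H$-inaccessible otherwise. *)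

(* Defs.v *)
From HB Require Import structures.
From mathcomp Require Import all_boot all_order all_algebra.
From mathcomp Require Import boolp classical_sets reals.

Set Implicit Arguments.
Unset Strict Implicit.
Unset Printing Implicit Defensive.

Import Order.TTheory GRing.Theory Num.Theory.

Local Open Scope classical_set_scope.
Local Open Scope quotient_scope.
Local Open Scope group_scope.

(* The letter (x, false) stands for x, and (x, true) for its formal inverse. *)
Definition pword (X : choiceType) : Type := seq (X * bool).
HB.instance Definition _ (X : choiceType) := Choice.on (pword X).

(* A relation l = r is given as the pair of words (l, r). *)
Inductive pres_eq (X : choiceType) (rels : set (pword X * pword X)) :
  pword X -> pword X -> Prop :=
| PresRefl w : pres_eq rels w w
| PresSym w1 w2 : pres_eq rels w1 w2 -> pres_eq rels w2 w1
| PresTrans w1 w2 w3 :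
    pres_eq rels w1 w2 -> pres_eq rels w2 w3 -> pres_eq rels w1 w3
| PresFree u x b v :
    pres_eq rels (u ++ [:: (x, b); (x, ~~ b)] ++ v) (u ++ v)
| PresRel u l r v :
    rels (l, r) -> pres_eq rels (u ++ l ++ v) (u ++ r ++ v).

Section Presentation.
Variables (X : choiceType) (rels : set (pword X * pword X)).
Implicit Types u v w : pword X.

Definition pres_eqb : rel (pword X) := fun w1 w2 => `[< pres_eq rels w1 w2 >].

Lemma pres_eqb_refl : reflexive pres_eqb.
Proof. by move=> w; apply/asboolP/PresRefl. Qed.

Lemma pres_eqb_sym : symmetric pres_eqb.
Proof. by move=> v w; apply: asbool_equiv_eq; split; apply: PresSym. Qed.

Lemma pres_eqb_trans : transitive pres_eqb.
Proof.
move=> v u w /asboolP uv /asboolP vw; apply/asboolP; exact: PresTrans uv vw.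
Qed.

Canonical pres_eqb_equiv :=
  EquivRel pres_eqb pres_eqb_refl pres_eqb_sym pres_eqb_trans.

Definition presented_group : Type := {eq_quot pres_eqb}.
HB.instance Definition _ := Choice.on presented_group.
HB.instance Definition _ := EqQuotient.on presented_group.

Lemma pres_pi w1 w2 :
  pres_eq rels w1 w2 <-> \pi_presented_group w1 = \pi_presented_group w2.
Proof.
by split=> [h|/eqmodP/asboolP//]; apply/eqmodP/asboolP.
Qed.

Lemma pres_eq_cat u1 u2 v1 v2 :
  pres_eq rels u1 u2 -> pres_eq rels v1 v2 ->
  pres_eq rels (u1 ++ v1) (u2 ++ v2).
Proof.
move=> hu hv; apply: (@PresTrans _ _ _ (u2 ++ v1)).
  elim: hu => [w|w1 w2 _|w1 w2 w3 _ + _|u x b v|u l r v h].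
  - exact: PresRefl.
  - exact: PresSym.
  - exact: PresTrans.
  - by rewrite -!catA; apply: PresFree.
  - by rewrite -!catA; apply: PresRel.
elim: hv => [w|w1 w2 _|w1 w2 w3 _ + _|u x b v|u l r v h].
- exact: PresRefl.
- exact: PresSym.
- exact: PresTrans.
- by rewrite !catA -!(catA (u2 ++ u)); apply: PresFree.
- by rewrite !catA -!(catA (u2 ++ u)); apply: PresRel.
Qed.

Definition pword_inv w : pword X := rev [seq (l.1, ~~ l.2) | l <- w].

Lemma pword_invK : involutive pword_inv.
Proof.
move=> w; rewrite /pword_inv map_rev revK -map_comp -[RHS]map_id.
by apply: eq_map => -[x b] /=; rewrite negbK.
Qed.

Lemma pres_eq_invr w : pres_eq rels (w ++ pword_inv w) [::].
Proof.
elim: w => [|[x b] w IH]; first exact: PresRefl.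
have -> : ((x, b) :: w) ++ pword_inv ((x, b) :: w) =
    [:: (x, b)] ++ (w ++ pword_inv w) ++ [:: (x, ~~ b)].
  by rewrite /pword_inv /= rev_cons -cats1 !catA.
apply: (@PresTrans _ _ _ ([:: (x, b)] ++ [::] ++ [:: (x, ~~ b)])).
  apply: pres_eq_cat; first exact: PresRefl.
  by apply: pres_eq_cat => //; apply: PresRefl.
exact: (PresFree rels [::] x b [::]).
Qed.

Lemma pres_eq_invl w : pres_eq rels (pword_inv w ++ w) [::].
Proof. by rewrite -{2}[w]pword_invK; apply: pres_eq_invr. Qed.

Lemma pres_eq_inv w1 w2 :
  pres_eq rels w1 w2 -> pres_eq rels (pword_inv w1) (pword_inv w2).
Proof.
move=> h; apply: (@PresTrans _ _ _ (pword_inv w1 ++ w2 ++ pword_inv w2)).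
  rewrite -[X in pres_eq _ X]cats0; apply: pres_eq_cat; first exact: PresRefl.
  exact/PresSym/pres_eq_invr.
rewrite catA -[X in pres_eq _ _ X]cat0s; apply: pres_eq_cat;
  last exact: PresRefl.
apply: (@PresTrans _ _ _ (pword_inv w1 ++ w1)); last exact: pres_eq_invl.
by apply: pres_eq_cat; [apply: PresRefl|apply: PresSym].
Qed.

Definition pres_one : presented_group := \pi_presented_group [::].
Definition pres_mul (g h : presented_group) : presented_group :=
  \pi_presented_group (repr g ++ repr h).
Definition pres_inv (g : presented_group) : presented_group :=
  \pi_presented_group (pword_inv (repr g)).

Lemma pres_mulE u v :
  pres_mul (\pi_presented_group u) (\pi_presented_group v)
    = \pi_presented_group (u ++ v).
Proof. by apply/pres_pi/pres_eq_cat; apply/pres_pi; rewrite reprK. Qed.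

Lemma pres_invE u :
  pres_inv (\pi_presented_group u) = \pi_presented_group (pword_inv u).
Proof. by apply/pres_pi/pres_eq_inv/pres_pi; rewrite reprK. Qed.

Fact pres_mulA : associative pres_mul.
Proof.
elim/quotP=> u _; elim/quotP=> v _; elim/quotP=> w _.
by rewrite (pres_mulE v w) (pres_mulE u v) !pres_mulE catA.
Qed.

Fact pres_mul1 : left_id pres_one pres_mul.
Proof. by elim/quotP=> u _; rewrite pres_mulE. Qed.

Fact pres_mulr1 : right_id pres_one pres_mul.
Proof. by elim/quotP=> u _; rewrite pres_mulE cats0. Qed.

Fact pres_mulV : left_inverse pres_one pres_inv pres_mul.
Proof.
elim/quotP=> u _; rewrite pres_invE pres_mulE.
exact/pres_pi/pres_eq_invl.
Qed.

Fact pres_mulrV : right_inverse pres_one pres_inv pres_mul.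
Proof.
elim/quotP=> u _; rewrite pres_invE pres_mulE.
exact/pres_pi/pres_eq_invr.
Qed.

HB.instance Definition _ := isGroup.Build presented_group
  pres_mulA pres_mul1 pres_mulr1 pres_mulV pres_mulrV.

Definition pres_gen (x : X) : presented_group :=
  \pi_presented_group [:: (x, false)].

Definition pword_eval (H : groupType) (f : X -> H) (w : pword X) : H :=
  \prod_(l <- w) (if l.2 then (f l.1)^-1 else f l.1).

Lemma presented_groupP (H : groupType) (f : X -> H) :
  (forall l r, rels (l, r) -> pword_eval f l = pword_eval f r) ->
  exists2 F : presented_group -> H,
    {morph F : g h / g * h} & forall x, F (pres_gen x) = f x.
Proof.
move=> hf; pose F (g : presented_group) := pword_eval f (repr g).
have evalE u v : pres_eq rels u v -> pword_eval f u = pword_eval f v.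
  elim=> {u v}// [u v w _ -> _ ->|u x b v|u l r v /hf] //.
    rewrite /pword_eval !big_cat !big_cons big_nil /= mulg1.
    by case: b; rewrite /= ?mulVg ?mulgV mul1g.
  by rewrite /pword_eval !big_cat => /= ->.
have FE w : F (\pi_presented_group w) = pword_eval f w.
  by apply/evalE/pres_pi; rewrite reprK.
exists F => [|x]; last by rewrite FE /pword_eval big_seq1.
elim/quotP=> u _; elim/quotP=> v _.
by rewrite [_ * _](pres_mulE u v) !FE /pword_eval big_cat.
Qed.

End Presentation.

Definition bs_a : bool := false.
Definition bs_t : bool := true.

Definition bs_rels (n : nat) : set (pword bool * pword bool) :=
  [set ([:: (bs_t, false); (bs_a, false); (bs_t, true)],
        nseq n (bs_a, false))].

Definition BS1 (n : nat) : groupType := presented_group (bs_rels n).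

Lemma BS1_rel n (a : BS1 n := pres_gen (bs_rels n) bs_a)
    (t : BS1 n := pres_gen (bs_rels n) bs_t) :
  t * a * t^-1 = a ^+ n.
Proof.
have aE k : a ^+ k = \pi_(presented_group (bs_rels n)) (nseq k (bs_a, false)).
  by elim: k => // k IH; rewrite expgS IH [LHS]pres_mulE.
rewrite aE [t * a]pres_mulE [t^-1]pres_invE [LHS]pres_mulE.
apply/pres_pi; have := @PresRel _ (bs_rels n) [::] _ _ [::] erefl.
by rewrite /= cats0.
Qed.

Section WordNorm.
Variable G : groupType.
Implicit Types (A : set G) (g h x : G) (w : seq G).

Definition spells A w g : Prop :=
  (forall x, x \in w -> A x \/ A x^-1) /\ \prod_(x <- w) x = g.

Definition generates A : Prop := forall g, exists w, spells A w g.

Definition genset : Type := {A : set G | `[< generates A >]}.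
HB.instance Definition _ := Choice.on genset.

Implicit Types S T U V : genset.

Definition gset S : set G := val S.

Lemma word_norm_subproof S g :
  exists k, `[< exists2 w, spells (gset S) w g & size w = k >].
Proof.
case: S => A /= /[dup] /asboolP h hA; have [w hw] := h g.
by exists (size w); apply/asboolP; exists w.
Qed.

Definition word_norm S g : nat := ex_minn (word_norm_subproof S g).

(* sup_(g in T) ||g||_S < oo, i.e. S is below T *)
Definition gset_le S T : bool :=
  `[< exists K : nat, forall g, gset T g -> (word_norm S g <= K)%N >].

Lemma word_normP S g :
  exists2 w, spells (gset S) w g & size w = word_norm S g.
Proof.
by rewrite /word_norm; case: ex_minnP => k /asboolP [w hw <-] _; exists w.
Qed.

Lemma word_norm_le S w g :
  spells (gset S) w g -> (word_norm S g <= size w)%N.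
Proof.
move=> h; rewrite /word_norm; case: ex_minnP => k _; apply.
by apply/asboolP; exists w.
Qed.

Lemma word_norm1 S : word_norm S 1 = 0%N.
Proof.
apply/eqP; rewrite -leqn0; apply: (@word_norm_le S [::]).
by split=> //; rewrite big_nil.
Qed.

Lemma word_normM S g h :
  (word_norm S (g * h) <= word_norm S g + word_norm S h)%N.
Proof.
have [u [uS <-] <-] := word_normP S g; have [v [vS <-] <-] := word_normP S h.
rewrite -size_cat; apply: word_norm_le; split; last by rewrite big_cat.
by move=> x; rewrite mem_cat => /orP[/uS|/vS].
Qed.

Lemma word_normV_le S g : (word_norm S g^-1 <= word_norm S g)%N.
Proof.
have [w [wS <-] <-] := word_normP S g.
rewrite -(size_map (fun x => x^-1)) -size_rev; apply: word_norm_le; split.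
  move=> x; rewrite mem_rev => /mapP[y /wS + ->].
  by rewrite invgK => -[]; [right|left].
elim: w {wS} => [|x w IH]; first by rewrite !big_nil invg1.
by rewrite map_cons rev_cons big_rcons IH big_cons invgM.
Qed.

Lemma word_normV S g : word_norm S g^-1 = word_norm S g.
Proof.
apply/eqP; rewrite eqn_leq word_normV_le /=.
by rewrite -{1}(invgK g) word_normV_le.
Qed.

Fact gset_le_refl : reflexive gset_le.
Proof.
move=> S; apply/asboolP; exists 1%N => g Sg.
apply: (@word_norm_le S [:: g]); split; last by rewrite big_seq1.
by move=> x; rewrite inE => /eqP ->; left.
Qed.

Fact gset_le_trans : transitive gset_le.
Proof.
move=> T S U /asboolP[K hK] /asboolP[L hL]; apply/asboolP; exists (L * K)%N.
move=> g /hL; have [w [wT <-] <-] := word_normP T g => hw.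
apply: leq_trans (leq_mul hw (leqnn K)); elim: w wT {hw} => [|x w IH] wT.
  by rewrite big_nil word_norm1.
rewrite big_cons /= mulSn; apply: leq_trans (word_normM _ _ _) _.
apply: leq_add; last by apply: IH => y yw; apply: wT; rewrite inE yw orbT.
by have [/hK //|/hK] := wT x (mem_head _ _); rewrite word_normV.
Qed.

Definition gset_sim : rel genset := fun S T => gset_le S T && gset_le T S.

Lemma gset_sim_refl : reflexive gset_sim.
Proof. by move=> S; rewrite /gset_sim gset_le_refl. Qed.

Lemma gset_sim_sym : symmetric gset_sim.
Proof. by move=> S T; rewrite /gset_sim andbC. Qed.

Lemma gset_sim_trans : transitive gset_sim.
Proof.
move=> T S U /andP[ST TS] /andP[TU UT].
by rewrite /gset_sim (gset_le_trans ST TU) (gset_le_trans UT TS).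
Qed.

Canonical gset_sim_equiv :=
  EquivRel gset_sim gset_sim_refl gset_sim_sym gset_sim_trans.

Definition gclass : Type := {eq_quot gset_sim}.
HB.instance Definition _ := Choice.on gclass.
HB.instance Definition _ := EqQuotient.on gclass.

Definition gclass_le : rel gclass := fun c d => gset_le (repr c) (repr d).

Lemma gclass_le_pi S T :
  gclass_le (\pi_gclass S) (\pi_gclass T) = gset_le S T.
Proof.
rewrite /gclass_le.
have h V : gset_sim (repr (\pi_gclass V)) V.
  by apply/eqmodP; rewrite reprK.
have /andP[s1 s2] := h S; have /andP[t1 t2] := h T.
apply/idP/idP => le; first exact: gset_le_trans (gset_le_trans s2 le) t1.
exact: gset_le_trans (gset_le_trans s1 le) t2.
Qed.

Fact gclass_le_refl : reflexive gclass_le.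
Proof. by move=> c; rewrite -(reprK c) gclass_le_pi gset_le_refl. Qed.

Fact gclass_le_anti : antisymmetric gclass_le.
Proof.
by move=> c d; rewrite -(reprK c) -(reprK d) !gclass_le_pi => h; apply/eqmodP.
Qed.

Fact gclass_le_trans : transitive gclass_le.
Proof. by move=> d c e; apply: gset_le_trans. Qed.

Fact gclass_display : Order.disp_t. Proof. exact: Order.Disp tt tt. Qed.

HB.instance Definition _ := Order.Le_isPOrder.Build gclass_display gclass
  gclass_le_refl gclass_le_anti gclass_le_trans.

Lemma gclass_leE S T :
  (\pi_gclass S <= \pi_gclass T)%O =
  `[< exists K : nat, forall g, gset T g -> (word_norm S g <= K)%N >].
Proof. exact: gclass_le_pi. Qed.

End WordNorm.

Section Hyperbolic.
Local Open Scope ring_scope.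
Variables (R : realType) (X : Type) (d : X -> X -> R).

Definition gromov_product (w x y : X) : R := (d w x + d w y - d x y) / 2.

Definition gromov_hyperbolic : Prop := exists delta : R, forall w x y z,
  Num.min (gromov_product w x y) (gromov_product w y z) - delta
    <= gromov_product w x z.

End Hyperbolic.

Section CayleyGraph.
Local Open Scope ring_scope.
Variables (R : realType) (G : groupType) (S : genset G).

Definition vertex_dist (g h : G) : R := (word_norm S (g^-1 * h)%g)%:R.

(* Points of the geometric realization of the Cayley graph: the point at
   position x on the edge of length 1 that goes from g to g * s. The end points
   of edges are not identified; points that represent the same vertex are at
   distance 0 from each other. *)
Record cayley_point := CayleyPoint {
  cp_base : G;
  cp_label : G;
  cp_pos : R;
  cp_labelP : gset S cp_label;
  cp_posP : 0 <= cp_pos <= 1 }.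

Definition cp_end (p : cayley_point) (b : bool) : G :=
  if b then (cp_base p * cp_label p)%g else cp_base p.

Definition cp_end_dist (p : cayley_point) (b : bool) : R :=
  if b then 1 - cp_pos p else cp_pos p.

(* Length of a shortest path from p to q that leaves the edge of p through its
   end b and enters the edge of q through its end c. *)
Definition via_dist (p q : cayley_point) (b c : bool) : R :=
  cp_end_dist p b + vertex_dist (cp_end p b) (cp_end q c) + cp_end_dist q c.

Definition cayley_dist (p q : cayley_point) : R :=
  let outer := Num.min
    (Num.min (via_dist p q false false) (via_dist p q false true))
    (Num.min (via_dist p q true false) (via_dist p q true true)) in
  if (cp_base p == cp_base q) && (cp_label p == cp_label q)
  then Num.min `|cp_pos p - cp_pos q| outer else outer.

Definition hyperbolic_cayley_graph : Prop := gromov_hyperbolic cayley_dist.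

End CayleyGraph.

Definition hyp_structures (R : realType) (G : groupType) : set (gclass G) :=
  [set c | exists2 S : genset G,
     hyperbolic_cayley_graph R S & c = \pi_(gclass G) S].

Definition H_accessible (R : realType) (G : groupType) : Prop :=
  exists2 c, hyp_structures R c & ubound (@hyp_structures R G) c.

Definition H_inaccessible (R : realType) (G : groupType) : Prop :=
  ~ H_accessible R G.

(* Main.v *)
Require Import Defs.
From HB Require Import structures.
From mathcomp Require Import all_boot all_order all_algebra.
From mathcomp Require Import boolp classical_sets reals.
From mathcomp Require Import zify lra.

(** Write BS(1,n) as the group of affine maps v |-> x + n^h v, with x in Z[1/n]
    and h in Z. It acts on two hyperbolic spaces: the hyperbolic plane, where
    the size of x is its absolute value, and the Bass-Serre tree, where the size
    of x is the power of n in its denominator. Each action gives a hyperbolic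
    structure, and both come out of one construction ([contracting_genset]): if
    x takes values in a ring filtered by balls B m with B m + B m inside B (m +
    1), and an element g rescales the balls by lam g levels, then the elements
    of height 0 with coordinate in B 0, together with s and s^2 where lam s = 1,
    generate the group, and the word norm is, up to an additive constant, half
    the distance 2 m - lam g of horoball geometry, where m is the first level at
    which the upward rays from 1 and from g have merged. Merging levels are
    ultrametric up to an additive constant, and this is the four-point
    condition.

    Let S be the generating set of a largest hyperbolic structure. Then the word
    norm of S dominates, up to a factor, the norms of both structures, so an
    element is far from 1 as soon as its coordinate x is large either in
    absolute value or in denominator. Put k = 2^j. The elements t^k a t^-k and
    t^-k a t^k have coordinates n^k and n^-k, and they commute. Hence there are
    two ways of spelling their product, one through t^k and one through t^-k,
    and these give a path of length O(k) from t^k to t^-k. Every point of it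
    except the ends has one of the coordinates n^k, n^-k, n^k + n^-k, so it
    stays at distance at least c k from 1. In a hyperbolic space the Gromov
    product at 1 of the ends of such a path is at least c k - O(log k)
    ([gprod_ge_path], [gprod_ge_powers]). For the ends t^k and t^-k this says
    that |t^2k| <= 2 |t^k| - 2 c k + O(log k), so for large k the ratio
    |t^k| / k drops by a fixed amount each time k is doubled. Since it
    is nonnegative, this is absurd ([no_geometric_drop]). *)

Set Implicit Arguments.
Unset Strict Implicit.
Unset Printing Implicit Defensive.

Import Order.TTheory GRing.Theory Num.Theory.

Local Open Scope classical_set_scope.
Local Open Scope quotient_scope.
Local Open Scope group_scope.

(** * Hyperbolicity read off the word norm *)

(** The four-point form of hyperbolicity for the distance [N (g^-1 * h)]: of the
    three ways to pair four points, the two with the largest sums of distances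
    have nearly equal sums.  Being symmetric and without base point, it stays
    within natural numbers. *)
Definition four_point_upto (G : groupType) (d : nat) (N : G -> nat) : Prop :=
  forall w x y z,
    (N (w^-1 * y)%g + N (x^-1 * z)%g <=
     maxn (N (w^-1 * x)%g + N (y^-1 * z)%g) (N (w^-1 * z)%g + N (x^-1 * y)%g)
       + d)%N.

Definition four_point (G : groupType) (N : G -> nat) : Prop :=
  exists d : nat, four_point_upto d N.

Section Coarse.
Local Open Scope ring_scope.

Lemma gromov_hyperbolic_coarse (R : realType) (X Y : Type)
    (d : X -> X -> R) (e : Y -> Y -> R) (f : X -> Y) (C : R) :
  (forall x y, `|d x y - e (f x) (f y)| <= C) ->
  gromov_hyperbolic e -> gromov_hyperbolic d.
Proof.
move=> de [delta he]; exists (delta + 3%:R * C) => w x y z.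
have := he (f w) (f x) (f y) (f z); rewrite /gromov_product.
have H p q : d p q - C <= e (f p) (f q) <= d p q + C.
  by have := de p q; rewrite ler_norml => /andP[? ?]; apply/andP; split; lra.
move: (H w x) (H w y) (H w z) (H x y) (H y z) (H x z) => {H}.
move=> /andP[? ?] /andP[? ?] /andP[? ?] /andP[? ?] /andP[? ?] /andP[? ?].
rewrite !lerBlDr !ge_min => /orP[?|?]; apply/orP; [left|right]; lra.
Qed.

Lemma vertex_hyperbolicP (R : realType) (G : groupType) (S : genset G) :
  gromov_hyperbolic (@vertex_dist R G S) <-> four_point (word_norm S).
Proof.
split=> [[delta h]|[d h]].
  have [D hD] : exists D : nat, delta <= D%:R.
    by exists (Num.truncn delta).+1; apply/ltW/truncnS_gt.
  exists (D + D)%N => w x y z; rewrite addn_maxl leq_max -!(ler_nat R) !natrD.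
  have := h w x y z; rewrite /gromov_product /vertex_dist.
  rewrite lerBlDr ge_min.
  by move=> /orP[?|?]; apply/orP; [right|left]; lra.
exists (d%:R / 2%:R) => w x y z.
have := h w x y z; rewrite addn_maxl leq_max -!(ler_nat R) !natrD.
rewrite /gromov_product /vertex_dist lerBlDr ge_min.
by move=> /orP[?|?]; apply/orP; [right|left]; lra.
Qed.

Lemma word_norm_letter (G : groupType) (S : genset G) g :
  gset S g -> (word_norm S g <= 1)%N.
Proof.
move=> Sg; apply: (@word_norm_le _ S [:: g]); split; last by rewrite big_seq1.
by move=> x; rewrite inE => /eqP ->; left.
Qed.

Lemma word_norm_inv_mul (G : groupType) (S : genset G) (g h u v : G) :
  (word_norm S (u^-1 * v)%g <= word_norm S (g^-1 * u)%g
     + word_norm S (g^-1 * h)%g + word_norm S (h^-1 * v)%g)%N.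
Proof.
have -> : (u^-1 * v = (g^-1 * u)^-1 * (g^-1 * h) * (h^-1 * v))%g.
  by rewrite invgM invgK !mulgA !mulgK.
by rewrite -(word_normV S (g^-1 * u)%g); apply: leq_trans (word_normM _ _ _) _;
  rewrite leq_add2r word_normM.
Qed.

(** A point of the Cayley graph is within distance 1 of the base of its edge, so
    passing to the vertices changes distances by at most 2. *)
Lemma cayley_dist_vertex (R : realType) (G : groupType) (S : genset G)
    (p q : cayley_point R S) :
  `|cayley_dist p q - vertex_dist R S (cp_base p) (cp_base q)| <= 2%:R.
Proof.
have end0 (r : cayley_point R S) b :
    ((word_norm S ((cp_base r)^-1 * cp_end r b)%g)%:R : R) <= 1.
  rewrite lern1; case: r => g s x Ss hx; case: b => /=.
    by rewrite /cp_end /= mulKg word_norm_letter.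
  by rewrite /cp_end /= mulVg word_norm1.
have endV (r : cayley_point R S) b :
    ((word_norm S ((cp_end r b)^-1 * cp_base r)%g)%:R : R) <= 1.
  by rewrite -word_normV invgM invgK.
have dist0 (r : cayley_point R S) b : 0 <= cp_end_dist r b <= 1.
  by have /andP[? ?] := cp_posP r; case: b; rewrite /cp_end_dist /=; lra.
set D := vertex_dist _ _ _ _.
have lo b c : D - 2%:R <= via_dist p q b c.
  have /andP[? _] := dist0 p b; have /andP[? _] := dist0 q c.
  have := word_norm_inv_mul S (cp_end p b) (cp_end q c) (cp_base p) (cp_base q).
  rewrite -(ler_nat R) !natrD -/(vertex_dist R S _ _) -/D => h.
  have := endV q c; have := end0 p b; have := endV p b.
  by rewrite /via_dist /vertex_dist; lra.
have hi : via_dist p q false false <= D + 2%:R.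
  have /andP[_ ?] := dist0 p false; have /andP[_ ?] := dist0 q false.
  by rewrite /via_dist -/D; lra.
have outer : D - 2%:R <= Num.min
    (Num.min (via_dist p q false false) (via_dist p q false true))
    (Num.min (via_dist p q true false) (via_dist p q true true)) <= D + 2%:R.
  by rewrite !le_min !lo /= !ge_min hi.
rewrite ler_distl /cayley_dist; case: ifP => // /andP[/eqP E _].
move: outer => /andP[lo' hi'].
rewrite le_min lo' ge_min hi' orbT !andbT.
have -> : D = 0 by rewrite /D /vertex_dist E mulVg word_norm1.
by have := normr_ge0 (cp_pos p - cp_pos q); lra.
Qed.

Lemma hyperbolic_cayley_four_point (R : realType) (G : groupType)
    (S : genset G) :
  four_point (word_norm S) -> hyperbolic_cayley_graph R S.
Proof.
move=> /(vertex_hyperbolicP R S).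
exact: gromov_hyperbolic_coarse (@cayley_dist_vertex R G S).
Qed.

Lemma four_point_hyperbolic_cayley (R : realType) (G : groupType)
    (S : genset G) (s : G) :
  gset S s -> hyperbolic_cayley_graph R S -> four_point (word_norm S).
Proof.
move=> Ss h; apply/(vertex_hyperbolicP R S).
have u : 0 <= (0 : R) <= 1 by rewrite lexx ler01.
apply: (gromov_hyperbolic_coarse (f := fun g => CayleyPoint g Ss u)) h => g k.
rewrite distrC; exact: (cayley_dist_vertex (CayleyPoint g Ss u)).
Qed.

End Coarse.

(** * Hyperbolic Cayley graphs from contracting actions *)

Section Spells.
Variables (G : groupType) (A : set G).

Lemma spells_nil : spells A [::] 1.
Proof. by split; rewrite ?big_nil. Qed.

Lemma spells_letter g : A g \/ A g^-1 -> spells A [:: g] g.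
Proof. by move=> Ag; split=> [x|]; rewrite ?big_seq1 // inE => /eqP ->. Qed.

Lemma spells_cat u v g h :
  spells A u g -> spells A v h -> spells A (u ++ v) (g * h).
Proof.
move=> [uA <-] [vA <-]; split; last by rewrite big_cat.
by move=> x; rewrite mem_cat => /orP[/uA|/vA].
Qed.

Lemma spells_expg u m : A u \/ A u^-1 -> A (u ^+ 2) \/ A (u ^+ 2)^-1 ->
  exists2 w, spells A w (u ^+ m) & (2 * size w <= m + 1)%N.
Proof.
move=> Au Au2; elim/ltn_ind: m => -[|[|m]] IH.
- by exists [::] => //; apply: spells_nil.
- by exists [:: u] => //; apply: spells_letter.
have [w hw lew] := IH m (leqW (leqnn _)).
exists ([:: u ^+ 2] ++ w); last by rewrite /=; lia.
rewrite -[m.+2]/(2 + m)%N expgnDr.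
by apply: spells_cat hw; apply: spells_letter.
Qed.

End Spells.

(** The data of a contracting action: [lam] is the height, [s] raises it by 1,
    [x] is a cocycle, and [B m] is the ball of level [m], which [g] carries to
    the ball of level [m + lam g]. *)
Section Horoball.
Variables (G : groupType) (V : pzRingType).
Variables (lam : G -> int) (chi x : G -> V) (B : int -> V -> Prop) (s : G).

Hypothesis lamM : forall g h, (lam (g * h) = lam g + lam h)%R.
Hypothesis xM : forall g h, (x (g * h) = x g + chi g * x h)%R.
Hypothesis lam_s : lam s = 1%R.
Hypothesis x_s : x s = 0%R.
Hypothesis B_le : forall (k m : int) v, (k <= m)%R -> B k v -> B m v.
Hypothesis B_add :
  forall (k m : int) u v, (k <= m)%R -> B k u -> B m v -> B (m + 1)%R (u + v)%R.
Hypothesis B_opp : forall (m : int) v, B m v -> B m (- v)%R.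
Hypothesis B_chi : forall g m v, B m v -> B (m + lam g)%R (chi g * v)%R.
Hypothesis B_exists : forall g, exists m, B m (x g).

(** The square of [s] makes vertical motion twice as fast.  A move within the
    ball [B 0] can raise the merging level by 1, hence the horoball distance by
    2; with [s ^+ 2] among the letters, 2 is also what one vertical letter can
    add, so no loss accumulates along a word and the word norm is half the
    horoball distance up to an additive constant. *)
Definition horo_gens : set G :=
  [set g | lam g = 0%R /\ B 0%R (x g)] `|` [set s; s ^+ 2].

(** The upward rays [s ^+ i] from 1 and [g * s ^+ i] from [g] have merged, up to
    an element of [B 0], when they reach height [m]. *)
Definition level (g : G) (m : int) : Prop :=
  [/\ (0 <= m)%R, (lam g <= m)%R & B m (x g)].

Let lam1 : lam 1 = 0%R.
Proof. by have := lamM 1 1; rewrite mulg1 => h; lia. Qed.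

Let lamV g : lam g^-1 = (- lam g)%R.
Proof. by have := lamM g^-1 g; rewrite mulVg lam1 => h; lia. Qed.

Let lamX g k : lam (g ^+ k) = (lam g * k%:Z)%R.
Proof.
elim: k => [|k IH]; first by rewrite expg0 lam1 mulr0.
by rewrite expgS lamM IH intS mulrDr mulr1.
Qed.

Let x1 : x 1 = 0%R.
Proof.
by have := xM 1 s; rewrite mul1g x_s mulr0 addr0 => <-.
Qed.

Let xV g : x g^-1 = (- (chi g^-1 * x g))%R.
Proof.
by have := xM g^-1 g; rewrite mulVg x1 => /esym /eqP; rewrite addr_eq0 => /eqP.
Qed.

Let x_expg g k : x g = 0%R -> x (g ^+ k) = 0%R.
Proof.
by move=> xg; elim: k => [|k IH]; rewrite ?expg0 // expgS xM xg IH mulr0 addr0.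
Qed.

Let x_sV : x s^-1 = 0%R.
Proof. by rewrite xV x_s mulr0 oppr0. Qed.

Lemma level_exists g : exists m, level g m.
Proof.
have [m Bm] := B_exists g; exists (`|m| + `|lam g|)%R.
by split; [lia|lia|apply: (B_le _ Bm); lia].
Qed.

(** The coarse ultrametric inequality for merging levels. *)
Lemma levelM g h m l k : level g m -> level h l ->
  (m < k)%R -> (lam g + l < k)%R -> level (g * h) k.
Proof.
move=> [m0 gm Bg] [l0 hl Bh] mk lk; have Bh' := B_chi g Bh.
split; [lia|rewrite lamM; lia|rewrite xM].
have -> : k = (k - 1 + 1)%R by lia.
have [ml|lm] := lerP m (l + lam g)%R.
  by apply: (B_le _ (B_add ml Bg Bh')); lia.
by rewrite [X in B _ X]addrC; apply: (B_le _ (B_add (ltW lm) Bh' Bg)); lia.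
Qed.

Lemma levelV g m : level g m -> level g^-1 (m - lam g).
Proof.
move=> [m0 gm Bg]; split; [lia|rewrite lamV; lia|rewrite xV].
by apply: B_opp; rewrite -lamV; apply: B_chi.
Qed.

Lemma level_step g h m : lam h = 0%R -> B 0%R (x h) ->
  level g m -> level (g * h) (m + 1).
Proof.
move=> h0 Bh gm; have [_ gm' _] := gm.
apply: (levelM (l := 0%R) gm _); [by split; rewrite ?h0|lia|lia].
Qed.

Lemma level_lift g h m k : x h = 0%R -> (m <= k)%R -> (lam g + lam h <= k)%R ->
  level g m -> level (g * h) k.
Proof.
move=> h0 mk hk [m0 gm Bg]; split; [lia|by rewrite lamM|].
by rewrite xM h0 mulr0 addr0; apply: (B_le _ Bg).
Qed.

(* The cocycle vanishes at 1, so 0 lies in some ball; powers of [s] carry it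
   into all of them. *)
Let B0 m : B m 0%R.
Proof.
have [k] := B_exists 1; rewrite x1 => Bk.
pose g := if (k <= m)%R then s ^+ `|m - k|%N else s^-1 ^+ `|m - k|%N.
have := B_chi g Bk; rewrite mulr0; apply: B_le; rewrite /g.
by case: ifP => h; rewrite lamX ?lamV lam_s; lia.
Qed.

Lemma level1 : level 1 0%R.
Proof. by split; rewrite ?lam1 // x1. Qed.

(** A letter raises the horoball distance [2 * m - lam g] by at most 2. *)
Lemma level_word w g : spells horo_gens w g ->
  exists2 m, level g m & (2 * m - lam g <= 2 * (size w)%:Z)%R.
Proof.
elim/last_ind: w g => [|w h IH] g [wA <-].
  by rewrite big_nil; exists 0%R; [exact: level1 | rewrite lam1; lia].
rewrite big_rcons /=; set g' := \prod_(_ <- _) _.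
have [|m gm mle] := IH g'.
  by split=> // y yw; apply: wA; rewrite mem_rcons inE yw orbT.
have g'm : (lam g' <= m)%R by case: gm.
have xs2 : x (s ^+ 2) = 0%R by apply: x_expg.
have ls2 : lam (s ^+ 2) = 2%R by rewrite lamX lam_s; lia.
have xs2V : x (s ^+ 2)^-1 = 0%R by rewrite xV xs2 mulr0 oppr0.
have lift k : x h = 0%R -> (m <= k)%R -> (lam g' + lam h <= k)%R ->
    (2 * k <= 2 * m + lam h + 2)%R ->
    exists2 m, level (g' * h) m &
      (2 * m - lam (g' * h) <= 2 * (size (rcons w h))%:Z)%R.
  move=> h0 mk hk le; exists k; first exact: level_lift gm.
  by rewrite lamM size_rcons; lia.
have step : lam h = 0%R -> B 0%R (x h) ->
    exists2 m, level (g' * h) m &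
      (2 * m - lam (g' * h) <= 2 * (size (rcons w h))%:Z)%R.
  move=> h0 Bh; exists (m + 1)%R; first exact: level_step.
  by rewrite lamM size_rcons; lia.
have [|[[h0 Bh]|[hs|hs]]|[[h0 Bh]|[hs|hs]]] := wA h.
- by rewrite mem_rcons mem_head.
- exact: step.
- by rewrite hs in lift *; apply: (lift (m + 1)%R) => //; rewrite ?lam_s; lia.
- by rewrite hs in lift *; apply: (lift (m + 2)%R) => //; rewrite ?ls2; lia.
- have h0' : lam h = 0%R by rewrite lamV in h0; lia.
  apply: step => //; have := B_opp (B_chi h Bh).
  by rewrite h0' addr0 -{1}(invgK h) -xV invgK.
- have E : h = s^-1 by rewrite -hs invgK.
  by rewrite E in lift *; apply: (lift m) => //; rewrite ?lamV ?lam_s; lia.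
- have E : h = (s ^+ 2)^-1 by rewrite -hs invgK.
  by rewrite E in lift *; apply: (lift m) => //; rewrite ?lamV ?ls2; lia.
Qed.

(** Climb from 1 to the merging level, cross by one element of the ball, and
    come down to [g]. *)
Lemma level_spell g m : level g m ->
  exists2 w, spells horo_gens w g & (2 * (size w)%:Z <= 2 * m - lam g + 4)%R.
Proof.
move=> [m0 gm Bg]; pose k := `|m|%N; pose l := `|(m - lam g)%R|%N.
pose q := s^-1 ^+ k * g * s ^+ l.
have sA : horo_gens s by right; left.
have s2A : horo_gens (s ^+ 2) by right; right.
have [u uA ule] := @spells_expg _ horo_gens s k (or_introl sA) (or_introl s2A).
have sVA : horo_gens (s^-1)^-1 by rewrite invgK.
have s2VA : horo_gens (s^-1 ^+ 2)^-1 by rewrite expVgn invgK.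
have [v vA vle] :=
  @spells_expg _ horo_gens s^-1 l (or_intror sVA) (or_intror s2VA).
have Bq : B 0%R (x q).
  rewrite /q !xM (x_expg _ x_s) (x_expg _ x_sV) mulr0 addr0 add0r.
  have -> : 0%R = (m + lam (s^-1 ^+ k))%R by rewrite lamX lamV lam_s; lia.
  exact: B_chi.
have lq : lam q = 0%R by rewrite /q !lamM !lamX lamV lam_s; lia.
exists (u ++ ([:: q] ++ v)); last by rewrite !size_cat /=; lia.
have -> : g = s ^+ k * (q * s^-1 ^+ l).
  by rewrite /q !expVgn !mulgA mulgV mul1g mulgK.
apply: spells_cat uA _; apply: spells_cat vA.
by apply: spells_letter; left; left.
Qed.

Lemma horo_gens_generate : generates horo_gens.
Proof.
move=> g; have [m gm] := level_exists g.
by have [w wA _] := level_spell gm; exists w.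
Qed.

Definition horo_genset : genset G :=
  exist _ horo_gens (asboolT horo_gens_generate).

Lemma word_norm_ge_level g :
  exists2 m, level g m & (2 * m - lam g <= 2 * (word_norm horo_genset g)%:Z)%R.
Proof.
by have [w wg <-] := word_normP horo_genset g; apply: level_word.
Qed.

Lemma ball_word_norm g : B (2 * (word_norm horo_genset g)%:Z)%R (x g).
Proof.
have [m [_ lm Bm] le] := word_norm_ge_level g; apply: (B_le _ Bm); lia.
Qed.

Lemma word_norm_le_level g m : level g m ->
  (2 * (word_norm horo_genset g)%:Z <= 2 * m - lam g + 4)%R.
Proof.
move=> /level_spell[w wg le]; have := @word_norm_le _ horo_genset w g wg; lia.
Qed.

Lemma word_norm_mul_le g h m l : level g m -> level h l ->
  (2 * (word_norm horo_genset (g * h))%:Z <= 2 * m - lam (g * h) + 6)%R \/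
  (2 * (word_norm horo_genset (g * h))%:Z
     <= 2 * (lam g + l) - lam (g * h) + 6)%R.
Proof.
move=> gm hl; have [ml|lm] := lerP m (lam g + l).
  have gh : level (g * h) (lam g + l + 1)%R by apply: levelM gm hl _ _; lia.
  by right; have := word_norm_le_level gh; lia.
have gh : level (g * h) (m + 1)%R by apply: levelM gm hl _ _; lia.
by left; have := word_norm_le_level gh; lia.
Qed.

(* Let [m(u,v)] be the merging height of [u] and [v], so that the distance is
   [2 * m(u,v)] minus the heights of [u] and [v].  Each diagonal of the
   quadrilateral is bounded by the larger of two consecutive edges, on either
   side of it; in all 16 cases the two diagonals together are bounded by two
   opposite edges. *)
Let four_edges (m1 m2 m3 m4 a b c d : int) (wx xy yz wz wy xz : nat) :
  (2 * m1 - (- a + b) <= 2 * wx%:Z)%R ->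
  (2 * m2 - (- b + c) <= 2 * xy%:Z)%R ->
  (2 * m3 - (- c + d) <= 2 * yz%:Z)%R ->
  (2 * m4 - (- a + d) <= 2 * wz%:Z)%R ->
  (2 * wy%:Z <= 2 * m1 - (- a + c) + 6)%R \/
  (2 * wy%:Z <= 2 * (- a + b + m2) - (- a + c) + 6)%R ->
  (2 * wy%:Z <= 2 * m4 - (- a + c) + 6)%R \/
  (2 * wy%:Z <= 2 * (- a + d + (m3 - (- c + d))) - (- a + c) + 6)%R ->
  (2 * xz%:Z <= 2 * m2 - (- b + d) + 6)%R \/
  (2 * xz%:Z <= 2 * (- b + c + m3) - (- b + d) + 6)%R ->
  (2 * xz%:Z <= 2 * (m1 - (- a + b)) - (- b + d) + 6)%R \/
  (2 * xz%:Z <= 2 * (- b + a + m4) - (- b + d) + 6)%R ->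
  (wy + xz <= wx + yz + 6)%N || (wy + xz <= wz + xy + 6)%N.
Proof. by move=> ? ? ? ? [?|?] [?|?] [?|?] [?|?]; lia. Qed.

Lemma horo_four_point : four_point (word_norm horo_genset).
Proof.
exists 6%N => w x' y z; rewrite addn_maxl leq_max.
set N := word_norm horo_genset.
have [m1 g1 n1] := word_norm_ge_level (w^-1 * x').
have [m2 g2 n2] := word_norm_ge_level (x'^-1 * y).
have [m3 g3 n3] := word_norm_ge_level (y^-1 * z).
have [m4 g4 n4] := word_norm_ge_level (w^-1 * z).
have d1 := word_norm_mul_le g1 g2; have d2 := word_norm_mul_le g4 (levelV g3).
have e1 := word_norm_mul_le g2 g3; have e2 := word_norm_mul_le (levelV g1) g4.
rewrite !(invgM, invgK, mulgA, mulgK) in d1 d2 e1 e2.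
rewrite !(lamM, lamV) in n1 n2 n3 n4 d1 d2 e1 e2.
exact: four_edges n1 n2 n3 n4 d1 d2 e1 e2.
Qed.

(** The second part is what a comparison with other generating sets uses: an
    element of small norm has its coordinate in a small ball. *)
Theorem contracting_genset : exists S : genset G,
  four_point (word_norm S) /\
  forall g, B (2 * (word_norm S g)%:Z)%R (x g).
Proof.
exists horo_genset; split; [exact: horo_four_point|exact: ball_word_norm].
Qed.

End Horoball.

(** * Commuting distorted elements obstruct hyperbolicity *)

Lemma affine_le_exp2 A C :
  exists j0, forall j, (j0 <= j)%N -> (A * j + C <= 2 ^ j)%N.
Proof.
(* [2 ^ (2 * c)] is at least [(c + 1) ^ 2], a quadratic bound in [A] and [C]. *)
pose c := (2 * A + C)%N; exists (2 * c)%N => j; elim: j => [|j IH].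
  by rewrite leqn0 /c => h; rewrite expn0; nia.
rewrite leq_eqVlt => /orP[/eqP <-|].
  rewrite [X in (_ <= _ ^ X)%N]mulnC expnM -mulnn.
  have h : (c < 2 ^ c)%N by apply: ltn_expl.
  by apply: leq_trans (leq_mul h h); rewrite /c; nia.
rewrite ltnS => /[dup] /IH h hj; rewrite expnS.
have Aj : (A <= A * j + C)%N.
  case: j {IH h} hj => [|j]; last by nia.
  by rewrite leqn0 /c; nia.
by rewrite mulnS; lia.
Qed.

(** For [0 < K], the inequality says that [N j / 2 ^ j] drops by at least
    [1 / (2 * K)] at each step from [j0] on. *)
Lemma no_geometric_drop (N : nat -> nat) (K j0 : nat) :
  ~ (forall j, (j0 <= j)%N -> (K * N j.+1 + 2 ^ j <= 2 * (K * N j))%N).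
Proof.
move=> h; have H i : (2 * K * N (j0 + i) + i * 2 ^ (j0 + i)
    <= 2 * K * N j0 * 2 ^ i)%N.
  elim: i => [|i IH]; first by rewrite addn0 expn0 mul0n addn0 muln1.
  have := h (j0 + i)%N (leq_addr _ _); rewrite addnS !expnS.
  by nia.
have := H (2 * K * N j0).+1; set c := (2 * K * N j0)%N.
have le : (2 ^ c.+1 <= 2 ^ (j0 + c.+1))%N by rewrite leq_exp2l ?leq_addl.
have gt0 : (0 < 2 ^ c.+1)%N by rewrite expn_gt0.
by have := leq_mul (leqnn c) le; lia.
Qed.

(** The conjugates [t ^+ k * a * t ^- k] and [t ^- k * a * t ^+ k] commute while
    both are at distance at least [k / K] from 1; the hypotheses [far_*] say the
    same of the points on the two paths spelling their product. *)
Section CommutingPowers.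
Variables (G : groupType) (N : G -> nat) (a t : G) (K : nat).
Hypothesis NM : forall g h, (N (g * h)%g <= N g + N h)%N.
Hypothesis NV : forall g, N g^-1 = N g.

Variable d : nat.
Hypothesis N4 : four_point_upto d N.

(** The Gromov product of [p] and [q] at 1 is at least [r]. *)
Definition gprod_ge (r : nat) (p q : G) : Prop :=
  (N (p^-1 * q)%g + 2 * r <= N p + N q)%N.

Lemma gprod_ge_le r r' p q : (r' <= r)%N -> gprod_ge r p q -> gprod_ge r' p q.
Proof. by rewrite /gprod_ge; lia. Qed.

Lemma gprod_ge_sym r p q : gprod_ge r p q -> gprod_ge r q p.
Proof.
by rewrite /gprod_ge -(NV (p^-1 * q)) invgM invgK [(N q + N p)%N]addnC.
Qed.

Lemma gprod_ge_trans r p q s :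
  gprod_ge r p q -> gprod_ge r q s -> gprod_ge (r - d) p s.
Proof.
have := N4 1 p q s; have := NM p^-1 s; rewrite /gprod_ge !invg1 !mul1g NV.
set ps := N (p^-1 * s)%g; set qs := N (q^-1 * s)%g; set pq := N (p^-1 * q)%g.
by lia.
Qed.

Lemma gprod_ge_step r p u : (r <= N (p * u)%g)%N ->
  gprod_ge (r - N u) p (p * u).
Proof.
move: (NM p u) (NM p^-1 (p * u)); rewrite /gprod_ge mulKg NV.
by set pu := N (p * u)%g; lia.
Qed.

(** Bisecting a path of [2 ^ j] steps costs [d] at each of the [j] levels. *)
Lemma gprod_ge_path r p u j :
  (forall i, (i <= 2 ^ j)%N -> (r <= N (p * u ^+ i)%g)%N) ->
  gprod_ge (r - N u - j * d) p (p * u ^+ (2 ^ j)).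
Proof.
elim: j p => [|j IH] p h.
  rewrite expn0 expg1 mul0n subn0; apply: gprod_ge_step.
  by have := h 1%N; rewrite expg1; apply.
have -> : (r - N u - j.+1 * d = r - N u - j * d - d)%N by rewrite mulSn; lia.
have E : p * u ^+ (2 ^ j.+1) = p * u ^+ (2 ^ j) * u ^+ (2 ^ j).
  by rewrite -mulgA -expgnDr expnS mul2n addnn.
rewrite E; apply: gprod_ge_trans (IH _ _) => [|i hi].
  by apply: IH => i hi; apply: h; rewrite expnS; lia.
by rewrite -mulgA -expgnDr; apply: h; rewrite expnS; lia.
Qed.

Hypothesis K0 : (0 < K)%N.
Hypothesis commute_conj : forall k,
  commute (t ^+ k * a * t ^- k) (t ^- k * a * t ^+ k).
Hypothesis far_up : forall k i, (k <= K * N (t ^+ k * a * t^-1 ^+ i)%g)%N.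
Hypothesis far_up_down : forall k i,
  (k <= K * N (t ^+ k * a * t ^- (2 * k) * a * t ^+ i)%g)%N.
Hypothesis far_down : forall k i, (k <= K * N (t ^- k * a * t ^+ i)%g)%N.
Hypothesis far_down_up : forall k i,
  (k <= K * N (t ^- k * a * t ^+ (2 * k) * a * t^-1 ^+ i)%g)%N.

Lemma commuting_corner k :
  t ^+ k * a * t ^- (2 * k) * a * t ^+ k =
  t ^- k * a * t ^+ (2 * k) * a * t^-1 ^+ k.
Proof.
have := commute_conj k; rewrite /commute expVgn mul2n -addnn expgnDr invgM.
by rewrite !mulgA.
Qed.

(** The path from [t ^+ 2 ^ j] to [t ^- 2 ^ j] has eight segments, four on each
    side of the common value of [commuting_corner]; joining them by halves
    costs three more levels of bisection. *)
Lemma gprod_ge_powers j :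
  gprod_ge (2 ^ j %/ K - N a - N t - (j + 4) * d) (t ^+ (2 ^ j)) (t ^- (2 ^ j)).
Proof.
set k := (2 ^ j)%N; set r := (k %/ K)%N.
have rle g : (k <= K * N g)%N -> (r <= N g)%N.
  move=> h; rewrite /r -(leq_pmul2l K0); apply: leq_trans h.
  by rewrite mulnC leq_trunc_div.
have K2 : (2 ^ j.+1 = 2 * k)%N by rewrite expnS.
pose R := (r - N a - N t - j.+1 * d)%N.
have corner := commuting_corner k.
have e1 : gprod_ge R (t ^+ k) (t ^+ k * a).
  apply: (@gprod_ge_le (r - N a)); first by rewrite /R; lia.
  apply: gprod_ge_step; apply: rle.
  by have := far_up k 0; rewrite expg0 mulg1.
have e2 : gprod_ge R (t ^+ k * a) (t ^+ k * a * t ^- (2 * k)).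
  apply: (@gprod_ge_le (r - N t^-1 - j.+1 * d)); first by rewrite /R NV; lia.
  by rewrite -K2 -expVgn; apply: gprod_ge_path => i _; apply/rle/far_up.
have e3 : gprod_ge R (t ^+ k * a * t ^- (2 * k))
    (t ^+ k * a * t ^- (2 * k) * a).
  apply: (@gprod_ge_le (r - N a)); first by rewrite /R; lia.
  apply: gprod_ge_step; apply: rle.
  by have := far_up_down k 0; rewrite expg0 mulg1.
have e4 : gprod_ge R (t ^+ k * a * t ^- (2 * k) * a)
    (t ^+ k * a * t ^- (2 * k) * a * t ^+ k).
  apply: (@gprod_ge_le (r - N t - j * d)); first by rewrite /R mulSn; lia.
  by apply: gprod_ge_path => i _; apply/rle/far_up_down.
have f1 : gprod_ge R (t ^- k) (t ^- k * a).
  apply: (@gprod_ge_le (r - N a)); first by rewrite /R; lia.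
  apply: gprod_ge_step; apply: rle.
  by have := far_down k 0; rewrite expg0 mulg1.
have f2 : gprod_ge R (t ^- k * a) (t ^- k * a * t ^+ (2 * k)).
  apply: (@gprod_ge_le (r - N t - j.+1 * d)); first by rewrite /R; lia.
  by rewrite -K2; apply: gprod_ge_path => i _; apply/rle/far_down.
have f3 : gprod_ge R (t ^- k * a * t ^+ (2 * k))
    (t ^- k * a * t ^+ (2 * k) * a).
  apply: (@gprod_ge_le (r - N a)); first by rewrite /R; lia.
  apply: gprod_ge_step; apply: rle.
  by have := far_down_up k 0; rewrite expg0 mulg1.
have f4 : gprod_ge R (t ^- k * a * t ^+ (2 * k) * a)
    (t ^- k * a * t ^+ (2 * k) * a * t^-1 ^+ k).
  apply: (@gprod_ge_le (r - N t^-1 - j * d)); first by rewrite /R NV mulSn; lia.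
  by apply: gprod_ge_path => i _; apply/rle/far_down_up.
have e := gprod_ge_trans (gprod_ge_trans e1 e2) (gprod_ge_trans e3 e4).
have f := gprod_ge_trans (gprod_ge_trans f1 f2) (gprod_ge_trans f3 f4).
rewrite corner in e.
apply: gprod_ge_le (gprod_ge_trans e (gprod_ge_sym f)).
by rewrite /R mulSn mulnDl; lia.
Qed.

Lemma commuting_powers_absurd : False.
Proof.
have [j0 hj0] := affine_le_exp2 (2 * K * d) (2 * K * (N a + N t + 4 * d + 1)).
apply: (@no_geometric_drop (fun j => N (t ^+ (2 ^ j))) K j0) => j /hj0 h.
have := gprod_ge_powers j; rewrite /gprod_ge NV -invgM -expgnDr addnn.
rewrite -mul2n -expnS NV.
set M := N (t ^+ _); set L := N (t ^+ _); set r := (_ - _)%N => e.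
have : (2 ^ j <= 2 * K * r)%N.
  have := ltn_ceil (2 ^ j) K0; rewrite /r.
  set q := (2 ^ j %/ K)%N; set e2 := (2 ^ j)%N in h * => hq.
  nia.
nia.
Qed.

End CommutingPowers.

(** * Affine coordinates on BS(1,n) *)

Section AffineGroup.
Local Open Scope ring_scope.

(** The pair [(v, k)] is the map [u |-> v + n.+1 ^ k * u]. *)
Definition affine_group (n : nat) : Type := (rat * int)%type.
HB.instance Definition _ n := Choice.on (affine_group n).

Variable n : nat.
Implicit Types p q r : affine_group n.

Definition affine_one : affine_group n := (0, 0).
Definition affine_mul p q : affine_group n :=
  (p.1 + n.+1%:R ^ p.2 * q.1, p.2 + q.2).
Definition affine_inv p : affine_group n :=
  (- (n.+1%:R ^ (- p.2) * p.1), - p.2).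

Let n0 : n.+1%:R != 0 :> rat. Proof. by rewrite pnatr_eq0. Qed.

Fact affine_mulA : associative affine_mul.
Proof.
move=> p q r; rewrite /affine_mul /=; congr (_, _); last exact: addrA.
by rewrite expfzDr // mulrDr !addrA mulrA.
Qed.

Fact affine_mul1 : left_id affine_one affine_mul.
Proof. by case=> v k; rewrite /affine_mul /= expr0z mul1r !add0r. Qed.

Fact affine_mulr1 : right_id affine_one affine_mul.
Proof. by case=> v k; rewrite /affine_mul /= mulr0 !addr0. Qed.

Fact affine_mulV : left_inverse affine_one affine_inv affine_mul.
Proof. by case=> v k; rewrite /affine_mul /= !addNr. Qed.

Fact affine_mulrV : right_inverse affine_one affine_inv affine_mul.
Proof.
case=> v k; rewrite /affine_mul /= mulrN mulrA -expfzDr // subrr expr0z mul1r.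
by rewrite !subrr.
Qed.

HB.instance Definition _ := isGroup.Build (affine_group n)
  affine_mulA affine_mul1 affine_mulr1 affine_mulV affine_mulrV.

End AffineGroup.

Section BS1.
Variable n : nat.
Notation G := (BS1 n.+1).
Notation a := (pres_gen (bs_rels n.+1) bs_a).
Notation t := (pres_gen (bs_rels n.+1) bs_t).

Lemma BS1_coordinates : exists (x : G -> rat) (h : G -> int),
  [/\ forall g k, (x (g * k)%g = x g + n.+1%:R ^ h g * x k)%R,
      forall g k, (h (g * k)%g = h g + h k)%R,
      x a = 1%R /\ h a = 0%R & x t = 0%R /\ h t = 1%R].
Proof.
pose f (b : bool) : affine_group n := if b then (0%R, 1%R) else (1%R, 0%R).
have [l r [-> ->]|F FM Ff] := @presented_groupP _ (bs_rels n.+1) _ f.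
  have -> : pword_eval f (nseq n.+1 (bs_a, false)) = (n.+1%:R%R, 0%R).
    elim: n.+1 => [|k IH]; first by rewrite /pword_eval big_nil.
    rewrite /pword_eval /= big_cons -/(pword_eval f _) IH.
    rewrite [LHS]/(affine_mul _ _) /affine_mul /= expr0z mul1r addr0.
    by rewrite [k.+1%:R%R]mulrS.
  rewrite /pword_eval !big_cons big_nil mulg1 /=.
  rewrite [LHS]/(affine_mul _ (affine_mul _ (affine_inv _))).
  rewrite /affine_mul /affine_inv /= expr1z expr0z.
  by rewrite !(mulr0, oppr0, mulr1, addr0, add0r, subrr).
exists (fun g => (F g).1), (fun g => (F g).2).
by split=> [g k|g k||]; rewrite ?FM ?Ff.
Qed.

Lemma BS1_ind (P : G -> Prop) : P 1 -> (forall g h, P g -> P h -> P (g * h)) ->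
  (forall g, P g -> P g^-1) -> P a -> P t -> forall g, P g.
Proof.
move=> P1 PM PV Pa Pt; elim/quotP=> w _.
elim: w => [|[b s] w IH]; first exact: P1.
have -> : \pi_(presented_group (bs_rels n.+1)) ((b, s) :: w)
    = \pi_(presented_group (bs_rels n.+1)) [:: (b, s)]
      * \pi_(presented_group (bs_rels n.+1)) w :> G.
  by rewrite [RHS]pres_mulE.
apply: PM IH; case: s; last by case: b.
have -> : \pi_(presented_group (bs_rels n.+1)) [:: (b, true)]
    = (pres_gen (bs_rels n.+1) b)^-1 :> G by rewrite [RHS]pres_invE.
by apply: PV; case: b.
Qed.

Lemma BS1_conj_expg k : t ^+ k * a * t ^- k = a ^+ (n.+1 ^ k) :> G.
Proof.
elim: k => [|k IH]; first by rewrite expn0 !expg0 invg1 mulg1 mul1g expg1.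
have E g m : t * g ^+ m * t^-1 = (t * g * t^-1) ^+ m.
  elim: m => [|m IHm]; first by rewrite !expg0 mulg1 mulgV.
  by rewrite !expgS -IHm !mulgA mulgVK.
have -> : t ^+ k.+1 * a * t ^- k.+1 = t * (t ^+ k * a * t ^- k) * t^-1.
  by rewrite expgS invgM !mulgA.
by rewrite IH E BS1_rel -expgnA -expnS.
Qed.

(** Conjugating by [t ^+ k] turns this into the fact that [a] commutes with
    [t ^+ (k + k) * a * t ^- (k + k)], which is a power of [a]. *)
Lemma BS1_commute_conj k :
  commute (t ^+ k * a * t ^- k : G) (t ^- k * a * t ^+ k).
Proof.
have H : commute (t ^+ (k + k) * a * t ^- (k + k) : G) a.
  by rewrite BS1_conj_expg; apply/commute_sym/commuteX/commute_refl.
have : commute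
    ((t ^+ (k + k) * a * t ^- (k + k) : G) ^ (t ^+ k)) (a ^ (t ^+ k)).
  by rewrite /commute -!conjMg H.
rewrite !conjgE expgnDr invgM !mulgA mulVg mul1g.
by rewrite !mulgVK.
Qed.

End BS1.

(** * The plane, the tree, and their common upper bounds *)

Lemma word_norm_gset_le (G : groupType) (S T : genset G) : gset_le S T ->
  exists K, forall g, (word_norm S g <= K * word_norm T g)%N.
Proof.
move=> /asboolP[K hK]; exists K => g.
have [w [wT <-] <-] := word_normP T g; elim: w wT => [|x w IH] wT.
  by rewrite big_nil word_norm1.
rewrite big_cons /= mulnS; apply: leq_trans (word_normM _ _ _) _.
apply: leq_add; last by apply: IH => y yw; apply: wT; rewrite inE yw orbT.
by have [/hK //|/hK] := wT x (mem_head _ _); rewrite word_normV.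
Qed.

Lemma genset_nonempty (G : groupType) (S : genset G) (g : G) :
  g != 1 -> exists s, gset S s.
Proof.
have [w [wS <-] _] := word_normP S g.
case: w wS => [|y w] wS; first by rewrite big_nil eqxx.
by move=> _; have [?|?] := wS y (mem_head _ _); [exists y|exists y^-1].
Qed.

Section Structures.
Variable n : nat.
Hypothesis n_gt0 : (0 < n)%N.
Notation G := (BS1 n.+1).
Notation a := (pres_gen (bs_rels n.+1) bs_a).
Notation t := (pres_gen (bs_rels n.+1) bs_t).
Notation b := (n.+1%:R : rat)%R.

Variables (x : G -> rat) (h : G -> int).
Hypothesis xM : forall g k, (x (g * k)%g = x g + b ^ h g * x k)%R.
Hypothesis hM : forall g k, (h (g * k)%g = h g + h k)%R.
Hypothesis x_a : x a = 1%R.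
Hypothesis h_a : h a = 0%R.
Hypothesis x_t : x t = 0%R.
Hypothesis h_t : h t = 1%R.

Let b0 : (b != 0)%R. Proof. by rewrite pnatr_eq0. Qed.
Let b1 : (1 < b)%R. Proof. by rewrite ltr1n. Qed.

Let h1 : h 1 = 0%R.
Proof. by have := hM 1 1; rewrite mulg1 => e; lia. Qed.

Let hV g : h g^-1 = (- h g)%R.
Proof. by have := hM g^-1 g; rewrite mulVg h1 => e; lia. Qed.

Let x1 : x 1 = 0%R.
Proof. by have := xM 1 t; rewrite mul1g x_t mulr0 addr0. Qed.

Let xV g : x g^-1 = (- (b ^ (- h g)%R * x g))%R.
Proof.
have := xM g^-1 g; rewrite mulVg x1 hV => /esym /eqP.
by rewrite addr_eq0 => /eqP.
Qed.

Let x_tV : x t^-1 = 0%R.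
Proof. by rewrite xV x_t mulr0 oppr0. Qed.

Let hX g k : h (g ^+ k) = (h g * k%:Z)%R.
Proof.
elim: k => [|k IH]; first by rewrite expg0 h1 mulr0.
by rewrite expgS hM IH intS mulrDr mulr1.
Qed.

Let xX g k : x g = 0%R -> x (g ^+ k) = 0%R.
Proof.
by move=> xg; elim: k => [|k IH]; rewrite ?expg0 // expgS xM xg IH mulr0 addr0.
Qed.

Let pow_int m : (0 <= m)%R -> (b ^ m)%R \is a Num.int.
Proof. by case: m => // m _; rewrite rpredX // rpred_nat. Qed.

(** The action on the hyperbolic plane. *)
Lemma BS1_plane_genset : exists S : genset G,
  four_point (word_norm S) /\
  forall g k, (b ^ k <= x g)%R -> (k <= 2 * (word_norm S g)%:Z)%R.
Proof.
pose B (m : int) (v : rat) := (`|v| <= b ^ m)%R.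
have bge0 m : (0 <= b ^ m)%R by rewrite exprz_ge0 ?ler0n.
have B_le (k m : int) v : (k <= m)%R -> B k v -> B m v.
  by move=> km; rewrite /B => /le_trans; apply; rewrite ler_weXz2l // ltW.
have B_add (k m : int) u v :
    (k <= m)%R -> B k u -> B m v -> B (m + 1)%R (u + v)%R.
  move=> km /(B_le _ _ _ km); rewrite /B => u_le v_le.
  apply: le_trans (ler_normD _ _) _; apply: le_trans (lerD u_le v_le) _.
  rewrite expfzDr // expr1z -[X in (X + X)%R]mulr1 -mulrDr ler_wpM2l //.
  by rewrite -natr1 lerD2r ler1n.
have B_opp (m : int) v : B m v -> B m (- v)%R by rewrite /B normrN.
have B_chi g (m : int) v : B m v -> B (m + h g)%R (b ^ h g * v)%R.
  rewrite /B normrM (ger0_norm (bge0 _)) expfzDr // mulrC => v_le.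
  by rewrite ler_wpM2r.
have B_exists g : exists m, B m (x g).
  exists ((Num.truncn `|x g|).+1%:Z)%R; rewrite /B.
  apply: le_trans (ltW (truncnS_gt _)) _.
  by rewrite -exprnP -natrX ler_nat ltnW // ltn_expl.
have [S [S4 SB]] :=
  contracting_genset hM xM h_t x_t B_le B_add B_opp B_chi B_exists.
exists S; split=> // g k hk; rewrite -(ler_eXz2l b1).
exact: le_trans hk (le_trans (ler_norm _) (SB g)).
Qed.

(** The action on the Bass-Serre tree.  Balls grow with the denominator, which
    [t] divides by [n.+1], so here the height is [- h]. *)
Lemma BS1_tree_genset : exists S : genset G,
  four_point (word_norm S) /\
  forall g k, (x g = b ^ (- k))%R -> (k <= 2 * (word_norm S g)%:Z)%R.
Proof.
pose B (m : int) (v : rat) := (b ^ m * v)%R \is a Num.int.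
have B_le (k m : int) v : (k <= m)%R -> B k v -> B m v.
  move=> km Bv; have -> : m = ((m - k) + k)%R by lia.
  by rewrite /B expfzDr // -mulrA rpredM // pow_int //; lia.
have B_add (k m : int) u v :
    (k <= m)%R -> B k u -> B m v -> B (m + 1)%R (u + v)%R.
  move=> km Bu Bv; apply: (B_le m); first by lia.
  by rewrite /B mulrDr rpredD //; apply: (B_le k).
have B_opp (m : int) v : B m v -> B m (- v)%R by rewrite /B mulrN rpredN.
have B_chi g (m : int) v : B m v -> B (m - h g)%R (b ^ h g * v)%R.
  by rewrite /B mulrA -expfzDr // subrK.
have B_exists g : exists m, B m (x g).
  elim/BS1_ind: g => [|g k [m Bg] [l Bk]|g [m Bg]||].
  - by exists 0%R; rewrite x1 /B mulr0.
  - exists (`|m| + `|l - h g| + 1)%R; rewrite xM.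
    apply: (B_add _ _ _ _ (lexx _)); first by apply: B_le Bg; lia.
    by apply: B_le (B_chi g _ _ Bk); lia.
  - exists (m + h g)%R; rewrite xV; apply: B_opp.
    by have := B_chi g^-1 m _ Bg; rewrite hV opprK.
  - by exists 0%R; rewrite /B x_a expr0z.
  - by exists 0%R; rewrite /B x_t mulr0.
have lamM g k : (- h (g * k)%g = - h g - h k)%R by rewrite hM; lia.
have lam_s : (- h t^-1 = 1)%R by rewrite hV opprK.
have [S [S4 SB]] := @contracting_genset G _ (fun g => - h g)%R
  (fun g => b ^ h g)%R x B t^-1 lamM xM lam_s x_tV
  B_le B_add B_opp B_chi B_exists.
exists S; split=> // g k xg; have := SB g; rewrite /B xg -expfzDr //.
rewrite leNgt => Bz; apply/negP => lt.
(* A power of [n.+1] with negative exponent lies strictly between 0 and 1. *)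
have pos : (0 < b ^ (2 * (word_norm S g)%:Z - k))%R.
  by rewrite exprz_gt0 // ltr0n.
have lt1 : (b ^ (2 * (word_norm S g)%:Z - k) < 1)%R.
  by rewrite -(expr0z b) ltr_eXz2l //; lia.
move: Bz pos lt1 => /intrP[z ->]; rewrite ltr0z ltrz1; lia.
Qed.

Let hVX g k : h (g ^- k) = (- (h g * k%:Z))%R.
Proof. by rewrite hV hX. Qed.

Let xVX k : x (t ^- k) = 0%R.
Proof. by rewrite -expVgn xX. Qed.

Let x_up k i : x (t ^+ k * a * t^-1 ^+ i) = (b ^ k%:Z)%R.
Proof.
by rewrite !(xM, hM, hX, xX, h_t, x_a, mulr0, addr0, add0r, mulr1, mul1r).
Qed.

Let x_down k i : x (t ^- k * a * t ^+ i) = (b ^ (- k%:Z))%R.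
Proof.
rewrite !(xM, hM, hVX, xVX, xX, h_t, x_a) //.
by rewrite !(mulr0, addr0, add0r, mulr1, mul1r).
Qed.

Let x_up_down k i :
  x (t ^+ k * a * t ^- (2 * k) * a * t ^+ i) = (b ^ k%:Z + b ^ (- k%:Z))%R.
Proof.
rewrite !(xM, hM, hVX, hX, xVX, xX, h_t, h_a, x_a) //.
rewrite !(mulr0, addr0, add0r, mulr1, mul1r).
by congr (_ + _ ^ _)%R; lia.
Qed.

Let x_down_up k i :
  x (t ^- k * a * t ^+ (2 * k) * a * t^-1 ^+ i) = (b ^ (- k%:Z) + b ^ k%:Z)%R.
Proof.
rewrite !(xM, hM, hVX, hX, xVX, xX, h_t, h_a, x_a) //.
rewrite !(mulr0, addr0, add0r, mulr1, mul1r).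
by congr (_ + _ ^ _)%R; lia.
Qed.

Lemma BS1_upper_bound_not_hyperbolic (S : genset G) :
  (forall U : genset G, four_point (word_norm U) -> gset_le U S) ->
  ~ four_point (word_norm S).
Proof.
move=> below [d S4].
have [P [P4 Pb]] := BS1_plane_genset.
have [T [T4 Tb]] := BS1_tree_genset.
have [KP KPle] := word_norm_gset_le (below P P4).
have [KT KTle] := word_norm_gset_le (below T T4).
pose K := (2 * (KP + KT) + 1)%N.
have bgt0 k : (0 < b ^ k)%R by rewrite exprz_gt0 // ltr0n.
have farP g (k : nat) : (b ^ k%:Z <= x g)%R -> (k <= K * word_norm S g)%N.
  by move=> /Pb; have := KPle g; rewrite /K; lia.
have farT g (k : nat) : (x g = b ^ (- k%:Z))%R -> (k <= K * word_norm S g)%N.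
  by move=> /Tb; have := KTle g; rewrite /K; lia.
apply: (@commuting_powers_absurd _ (word_norm S) a t K _ _ d S4).
- exact: word_normM.
- exact: word_normV.
- by rewrite /K addn1.
- exact: BS1_commute_conj.
- by move=> k i; apply: farP; rewrite x_up.
- by move=> k i; apply: farP; rewrite x_up_down lerDl ltW.
- by move=> k i; apply: farT; rewrite x_down.
- by move=> k i; apply: farP; rewrite x_down_up lerDr ltW.
Qed.

Lemma BS1_t_neq1 : t != 1 :> G.
Proof. by apply/eqP => e; have := h_t; rewrite e h1. Qed.

End Structures.

Theorem corollary1p2 (R : realType) (n : nat) (hn : (2 <= n)%N) :
  H_inaccessible R (BS1 n).
Proof.
case: n hn => // n n_gt0; move=> [c [S hS ->] ub].
have [x [h [xM hM [x_a h_a] [x_t h_t]]]] := BS1_coordinates n.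
have [s Ss] := genset_nonempty S (BS1_t_neq1 n_gt0 hM h_a h_t).
apply: (BS1_upper_bound_not_hyperbolic n_gt0 xM hM x_a h_a x_t h_t (S := S));
  last exact: four_point_hyperbolic_cayley Ss hS.
move=> U U4; rewrite -gclass_le_pi; apply: ub.
by exists U => //; apply: hyperbolic_cayley_four_point.
Qed.
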